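(* Let $m \geq 2$ be an integer and let $G$ be a finite group with center $Z(G)$ such that $G/Z(G) \cong D_{2m}$. Then the spectrum of the commuting graph $\Gamma_G$ of $G$ is $$\operatorname{Spec}(\Gamma_G) = \{(-1)^{(2m - 1)|Z(G)| - m - 1},\ (|Z(G)| - 1)^m,\ ((m - 1)|Z(G)| - 1)^1\}.$$
   Context: $D_{2m} = \langle a, b : a^{m} = b^2 = 1,\ bab^{-1} = a^{-1}\rangle$ denotes the dihedral group of order $2m$ (for $m=2$ this is $\mathbb{Z}_2\times\mathbb{Z}_2$). For a non-abelian group $G$ with center $Z(G)$, the commuting graph $\Gamma_G$ is the simple undirected graph with vertex set $G\setminus Z(G)$ in which two distinct vertices $x,y$ are adjacent if and only if $xy=yx$. The spectrum $\operatorname{Spec}(\mathcal{G})=\{\lambda_1^{k_1},\dots,\lambda_n^{k_n}\}$ of a finite graph $\mathcal{G}$ is the multiset of eigenvalues of its adjacency matrix, where $\lambda^{k}$ means that the eigenvalue $\lambda$ is listed with multiplicity $k$ (if the same value is listed more than once, the multiplicities add). *)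

(* Defs.v *)
From HB Require Import structures.
From mathcomp Require Import all_boot all_order all_algebra all_fingroup.
From mathcomp Require Import all_solvable.
Set Implicit Arguments.
Unset Strict Implicit.
Unset Printing Implicit Defensive.
Import GRing.Theory.
Local Open Scope ring_scope.

Section Spectrum.
Variable C : closedFieldType.

(* All eigenvalues of A, each repeated according to its algebraic             *)
(* multiplicity. The order of the list is arbitrary: compare spectra with     *)
(* perm_eq.                                                                   *)
Definition spectrum n (A : 'M[C]_n) : seq C :=
  sval (closed_field_poly_normal (char_poly A)).

Lemma char_poly_spectrum n (A : 'M[C]_n) :
  char_poly A = \prod_(z <- spectrum A) ('X - z%:P).
Proof.
rewrite /spectrum; case: closed_field_poly_normal => s /= {1}->.
by rewrite (monicP (char_poly_monic A)) scale1r.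
Qed.

Lemma mem_spectrum n (A : 'M[C]_n) (z : C) :
  (z \in spectrum A) = eigenvalue A z.
Proof. by rewrite eigenvalue_root_char char_poly_spectrum root_prod_XsubC. Qed.

Lemma size_spectrum n (A : 'M[C]_n) : size (spectrum A) = n.
Proof.
by apply/eqP; rewrite -eqSS -(size_char_poly A) char_poly_spectrum
  size_prod_XsubC.
Qed.

End Spectrum.

Definition adjacency_mx (R : pzSemiRingType) (V : finType) (e : rel V) :
    'M[R]_#|V| :=
  \matrix_(i, j) (e (enum_val i) (enum_val j))%:R.

Definition graph_spectrum (C : closedFieldType) (V : finType) (e : rel V) :
    seq C :=
  spectrum (adjacency_mx C e).

Section CommutingGraph.
Variables (gT : finGroupType) (G : {group gT}).

Definition noncentral : finType := {x : gT | x \in G :\: 'Z(G)%g}.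

Definition commuting_graph : rel noncentral :=
  fun x y => (x != y) && (val x * val y == val y * val x)%g.

Lemma commuting_graph_sym : symmetric commuting_graph.
Proof. by move=> x y; rewrite /commuting_graph eq_sym [in X in _ && X]eq_sym. Qed.

Lemma commuting_graph_irr : irreflexive commuting_graph.
Proof. by move=> x; rewrite /commuting_graph eqxx. Qed.

End CommutingGraph.

(* The presentation of 'D_(2 * m) with b * a * b^-1 instead of the library's  *)
(* a ^ b = b^-1 * a * b; it covers m = 2.                                     *)
Lemma Grp_dihedral_conj (m : nat) : (1 < m)%N ->
  ([set: 'D_(2 * m)] \isog
     Grp (a : b : a ^+ m, b ^+ 2, b * a * b^-1 = a^-1))%g.
Proof.
move=> m_gt1 rT H; rewrite mul2n (Grp_dihedral m_gt1).
apply: eq_existsb => -[x y] /=; rewrite !xpair_eqE.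
case: (y ^+ 2 =P 1)%g => //= y2; congr (_ && _).
suff yV : (y^-1 = y)%g by rewrite conjgE mulgA yV.
by apply/eqP; rewrite eq_invg_mul -expg2 y2.
Qed.

(* Main.v *)
Require Import Defs.
From HB Require Import structures.
From mathcomp Require Import all_boot all_order all_algebra all_fingroup.
From mathcomp Require Import all_solvable.
Set Implicit Arguments.
Unset Strict Implicit.
Unset Printing Implicit Defensive.
Import GRing.Theory.
Local Open Scope ring_scope.

(** The commuting graph of [G] turns out to be a disjoint union of cliques, and
    the spectrum of such a graph is read off from the sizes of the cliques.

    Spectrum of a union of cliques.  If the vertices are sorted into classes
    and two distinct vertices are adjacent exactly when they lie in the same
    class, then [A + 1 = P^T P], where [A] is the adjacency matrix and [P] the
    classes-by-vertices incidence matrix, while [P P^T] is diagonal with the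
    class sizes as entries.  Sylvester's determinant identity
    ([det_scalar_sub_mulmxC]) compares the characteristic polynomials of
    [P^T P] and [P P^T], so a class of size [s] contributes the eigenvalue
    [s - 1] and all the remaining eigenvalues are [-1]
    ([cluster_graph_spectrum]).

    Why the cliques.  All that matters about the dihedral quotient is its
    cyclic subgroup of order [m] and index 2 ([dihedral_cyclic_index2]).  Its
    preimage [T] in [G] is an abelian subgroup of index 2, because it is cyclic
    modulo central elements.  Let [x] lie in [G] but not in [T].  Then
    [G = T \cup T x], so an element of [T] commuting with [x] commutes with
    everything, i.e., is central ([cent_outside_index2_center]).  Hence no
    noncentral element of [T] commutes with [x], and [t x] with [t] in [T]
    commutes with [x] only when [t] is central.  The cliques are therefore
    [T \ Z(G)], of size [(m - 1) |Z(G)|], and the [m] cosets of [Z(G)] outside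
    [T], each of size [|Z(G)|] ([commuting_classP]). *)

(** * The spectrum of a disjoint union of cliques *)

(** Sylvester's identity: both sides are [t ^+ k] times the determinant of the
    block matrix [M] below, as shown by clearing its lower left block by column
    operations, respectively by row operations. *)
Lemma det_scalar_sub_mulmxC (R : comNzRingType) n k (t : R)
    (A : 'M_(n, k)) (B : 'M_(k, n)) :
  t ^+ k * \det (t%:M - A *m B) = t ^+ n * \det (t%:M - B *m A).
Proof.
pose M := block_mx t%:M A B 1%:M.
have detM : \det M = \det (t%:M - A *m B).
  have /(congr1 determinant) :
    M *m block_mx 1%:M 0 (- B) 1%:M = block_mx (t%:M - A *m B) A 0 1%:M.
    by rewrite mulmx_block !mulmx1 !mulmx0 !mul1mx mulmxN subrr !add0r.
  by rewrite det_mulmx det_lblock det_ublock !det1 !mulr1.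
have /(congr1 determinant) :
  block_mx 1%:M 0 (- B) t%:M *m M = block_mx t%:M A 0 (t%:M - B *m A).
  rewrite mulmx_block !mul1mx !mul0mx !addr0 !mulNmx mulmx1.
  by rewrite -scalar_mxC addNr addrC.
by rewrite det_mulmx det_lblock det_ublock !det_scalar expr1n mul1r -detM.
Qed.

(** Adding the identity to the adjacency matrix gives [P^T P], which has the
    same nonzero eigenvalues as the diagonal matrix [P P^T] of class sizes.
    Only the image of [c] indexes cliques, as empty fibers have none. *)
Lemma cluster_graph_spectrum (C : closedFieldType) (V I : finType)
    (e : rel V) (c : V -> I)
    (eE : forall x y, e x y = (x != y) && (c x == c y)) :
  perm_eq (graph_spectrum C e)
    (nseq (#|V| - #|c @: setT|) (-1)
     ++ [seq #|c @^-1: [set i]|%:R - 1 | i <- enum (c @: setT)]).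
Proof.
set S := c @: setT.
pose P : 'M[C]_(#|S|, #|V|) :=
  \matrix_(i, j) (c (enum_val j) == enum_val i)%:R.
have memS x : c x \in S by rewrite imset_f.
have PTP : adjacency_mx C e = P^T *m P - 1%:M.
  apply/matrixP=> i j; rewrite !mxE eE (inj_eq enum_val_inj).
  rewrite (bigD1 (enum_rank_in (memS (enum_val i)) (c (enum_val i)))) //=.
  rewrite !mxE enum_rankK_in // eqxx mul1r big1 ?addr0 => [|l].
    case: (i =P j) => [->|_] /=; first by rewrite eqxx subrr.
    by rewrite subr0 eq_sym.
  rewrite -(inj_eq enum_val_inj) enum_rankK_in // => /negPf ne_l.
  by rewrite !mxE eq_sym ne_l mul0r.
have PPT : P *m P^T = diag_mx (\row_i #|c @^-1: [set enum_val i]|%:R).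
  apply/matrixP=> i j; rewrite !mxE.
  under eq_bigr do rewrite !mxE.
  rewrite -(big_enum_val
    (fun x => (c x == enum_val i)%:R * (c x == enum_val j)%:R)).
  case: (i =P j) => [->|/eqP ne_ij].
    rewrite mulr1n -sum1_card natr_sum [RHS]big_mkcond /=.
    apply: eq_bigr => x _; rewrite !inE.
    by case: eqP => _; rewrite ?mulr1 ?mulr0.
  rewrite mulr0n big1 // => x _; case: eqP => [->|]; last by rewrite mul0r.
  by rewrite (inj_eq enum_val_inj) (negPf ne_ij) mulr0.
(* Since [A = P^T P - 1], the characteristic polynomial of [A] is that of     *)
(* [P^T P] with [X] replaced by [X + 1].                                      *)
have cpolyE : ('X + 1) ^+ #|S| * char_poly (adjacency_mx C e)
    = ('X + 1) ^+ #|V| * \prod_(i in S) ('X - (#|c @^-1: [set i]|%:R - 1)%:P).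
  pose P' := map_mx polyC P.
  have -> : char_poly (adjacency_mx C e) = \det (('X + 1)%:M - P'^T *m P').
    congr (\det _); rewrite /char_poly_mx PTP map_mxB map_mxM map_mx1 map_trmx.
    by rewrite opprB addrA raddfD.
  rewrite det_scalar_sub_mulmxC; congr (_ * _).
  rewrite map_trmx -map_mxM PPT map_diag_mx -diag_const_mx -raddfB det_diag.
  rewrite (big_enum_val
    (fun i => 'X - (#|c @^-1: [set i]|%:R - 1)%:P)).
  apply: eq_bigr => i _; rewrite !mxE polyCB opprB addrA.
  by rewrite addrAC.
apply: prod_XsubC_eq.
have X1_neq0 : ('X + 1 : {poly C}) ^+ #|S| != 0.
  by rewrite expf_neq0 // -size_poly_eq0 -[1]opprK -polyCN size_XsubC.
apply: (mulfI X1_neq0).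
rewrite -char_poly_spectrum cpolyE big_cat /= big_nseq big_map big_enum.
rewrite -Monoid.iteropE polyCN opprK mulrA -exprD subnKC //.
by rewrite -cardsT leq_imset_card.
Qed.

(** * Groups with an abelian subgroup of index 2 *)

Section AbelianIndex2.
Local Open Scope group_scope.
Variables (gT : finGroupType) (G T : {group gT}).
Hypotheses (sTG : T \subset G) (abT : abelian T) (indT : #|G : T| = 2).

(** [T] and [x] generate [G], and [t] commutes with both. *)
Lemma cent_outside_index2_center x t :
  x \in G :\: T -> t \in T -> commute x t -> t \in 'Z(G).
Proof.
move=> xGT tT cxt; have tG := subsetP sTG t tT.
apply/centerP; split=> // y yG.
have [yT | yT'] := boolP (y \in T); first exact: (centsP abT).
have : y \in T :* x by rewrite (rcoset_index2 sTG indT xGT) inE yT'.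
case/rcosetP=> u uT ->.
by apply: commuteM; [apply: (centsP abT) | apply: commute_sym].
Qed.

Hypothesis nabG : ~~ abelian G.

(** A central element outside [T] would make all of [T] central by the
    preceding lemma, and [G], generated by [T] and that element, abelian. *)
Lemma center_sub_index2 : 'Z(G) \subset T.
Proof.
apply: contraR nabG => /subsetPn[x xZ xT'].
have /centerP[xG xC] := xZ.
have xGT : x \in G :\: T by rewrite inE xT'.
suffices sTZ : T \subset 'Z(G).
  apply/center_idP/eqP; rewrite eqEsubset center_sub /=.
  apply/subsetP=> y yG.
  have [/(subsetP sTZ) // | yT'] := boolP (y \in T).
  have : y \in T :* x by rewrite (rcoset_index2 sTG indT xGT) inE yT'.
  by case/rcosetP=> u /(subsetP sTZ) uZ ->; rewrite groupM.
apply/subsetP=> t tT; apply: (cent_outside_index2_center xGT tT).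
by apply: xC; apply: (subsetP sTG).
Qed.

(** The clique containing a noncentral [x].  The trivial coset can label
    [T \ Z(G)] because noncentral elements have nontrivial cosets. *)
Definition commuting_class x : coset_of 'Z(G) :=
  if x \in T then 1 else coset 'Z(G) x.

Lemma norm_center x : x \in G -> x \in 'N('Z(G)).
Proof. exact/subsetP/normal_norm/center_normal. Qed.

(** If [x] is outside [T], a commuting [y] cannot be in [T], where it would be
    central; so [y = t x] with [t] in [T], and [t] commutes with [x] too, hence
    is central. *)
Lemma commuting_classP x y : x \in G :\: 'Z(G) -> y \in G :\: 'Z(G) ->
  (x * y == y * x) = (commuting_class x == commuting_class y).
Proof.
have mixed u v : u \in G :\: 'Z(G) -> v \in G :\: 'Z(G) -> u \in T ->
    v \notin T -> (u * v != v * u) && (1 != coset 'Z(G) v).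
  move=> /setDP[uG uZ'] /setDP[vG vZ'] uT vT'; apply/andP; split.
    apply: contra uZ' => /eqP cuv.
    by apply: (cent_outside_index2_center _ uT (commute_sym cuv)); apply/setDP.
  by apply: contra vZ' => /eqP/esym/coset_idr; apply; apply: norm_center.
move=> xGZ yGZ; rewrite /commuting_class.
have /setDP[xG xZ'] := xGZ; have /setDP[yG yZ'] := yGZ.
have [xT | xT'] := boolP (x \in T); have [yT | yT'] := boolP (y \in T).
- by rewrite (centsP abT x xT y yT) !eqxx.
- by have /andP[/negPf-> /negPf->] := mixed x y xGZ yGZ xT yT'.
- rewrite eq_sym [RHS]eq_sym.
  by have /andP[/negPf-> /negPf->] := mixed y x yGZ xGZ yT xT'.
have xGT : x \in G :\: T by apply/setDP.
have cosetP := rcoset_kercosetP (norm_center yG) (norm_center xG).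
rewrite [RHS]eq_sym -(sameP cosetP eqP).
have : y \in T :* x by rewrite (rcoset_index2 sTG indT xGT) inE yT'.
case/rcosetP=> t tT ->; rewrite mem_rcoset mulgK mulgA (inj_eq (mulIg x)).
apply/eqP/idP => [|tZ]; first exact: cent_outside_index2_center.
by apply/esym; case/centerP: tZ => _; apply.
Qed.

Lemma commuting_class_fiber1 :
  [set x in G :\: 'Z(G) | commuting_class x == 1] = T :\: 'Z(G).
Proof.
apply/setP=> x; rewrite in_set !in_setD /commuting_class.
have [xT | xT'] := boolP (x \in T); first by
  rewrite (subsetP sTG) // eqxx !andbT.
rewrite andbF; apply: contraNF xT' => /andP[/andP[xZ' xG] /eqP cx1].
by case/negP: xZ'; apply: coset_idr (norm_center xG) cx1.
Qed.

Lemma commuting_class_fiber x : x \in G :\: T ->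
  [set y in G :\: 'Z(G) | commuting_class y == coset 'Z(G) x] = 'Z(G) :* x.
Proof.
case/setDP=> xG xT'; apply/setP=> y; rewrite in_set in_setD /commuting_class.
have xZ' : x \notin 'Z(G) by apply: contra xT'; apply/subsetP/center_sub_index2.
have [yG | yG'] := boolP (y \in G); last first.
  rewrite andbF /=; apply/esym; apply: contraNF yG' => /rcosetP[u uZ ->].
  by rewrite groupM // (subsetP (center_sub G)).
rewrite andbT; have [yT | yT'] := boolP (y \in T).
  rewrite eq_sym; case: eqP => [cx1|_].
    by case/negP: xZ'; apply: coset_idr (norm_center xG) cx1.
  rewrite andbF mem_rcoset; apply/esym; apply: contraNF xT'.
  by move/(subsetP center_sub_index2); rewrite groupMl // groupV.
rewrite (contra (subsetP center_sub_index2 y) yT') /=.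
by apply/eqP/idP => /(rcoset_kercosetP (norm_center yG) (norm_center xG)).
Qed.

(** The complement of [T] is a coset [T x], so it contains as many cosets of
    the center as [T] does. *)
Lemma card_coset_outside_index2 : #|(G :\: T) / 'Z(G)| = #|T : 'Z(G)|.
Proof.
have /subsetPn[x xG xT'] : ~~ (G \subset T).
  apply/negP=> sGT; move: indT.
  by rewrite (eqP (_ : T :==: G)) ?indexgg // eqEsubset sTG.
have sTN : T \subset 'N('Z(G)).
  exact: subset_trans sTG (normal_norm (center_normal G)).
rewrite -(rcoset_index2 sTG indT (_ : x \in G :\: T)); last by apply/setDP.
rewrite /rcoset quotientMl // quotient_set1 ?norm_center //.
by rewrite card_rcoset card_quotient.
Qed.

End AbelianIndex2.

(** The cliques are [T \ Z(G)], of size [(h - 1) z], and [h] cosets of the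
    center, of size [z]; they cover [(2h - 1) z] vertices in all. *)
Theorem spectrum_commuting_graph_abelian_index2 (C : closedFieldType)
    (gT : finGroupType) (G T : {group gT}) :
  let z := #|'Z(G)%g| in let h := #|T : 'Z(G)|%g in
    T \subset G -> abelian T -> #|G : T|%g = 2%N -> ~~ abelian G ->
  perm_eq (graph_spectrum C (commuting_graph (G := G)))
    (nseq ((2 * h - 1) * z - h - 1)%N (-1)
     ++ nseq h (z%:R - 1) ++ nseq 1 ((h%:R - 1) * z%:R - 1)).
Proof.
move=> z h sTG abT indT nabG.
have sZT : 'Z(G)%g \subset T := center_sub_index2 sTG abT indT nabG.
have oT : #|T| = (z * h)%N by rewrite Lagrange.
have oG : #|G| = (z * h * 2)%N by rewrite -(Lagrange sTG) oT indT.
have z_gt0 : (0 < z)%N by apply: cardG_gt0.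
have h_gt1 : (1 < h)%N.
  (* If [T] were the center, then [G / Z(G)] would have order 2. *)
  rewrite ltn_neqAle eq_sym indexg_gt0 andbT.
  apply: contra nabG => /eqP h1; apply: cyclic_center_factor_abelian.
  apply: prime_cyclic; rewrite card_quotient ?normal_norm ?center_normal //.
  by rewrite -divgS ?center_sub // oG -/z h1 muln1 mulKn.
pose c (x : noncentral G) := commuting_class G T (val x).
pose Q := ((G :\: T) / 'Z(G))%g.
have oQ : #|Q| = h := card_coset_outside_index2 sTG indT.
have oV : #|noncentral G| = (z * (h * 2 - 1))%N.
  rewrite card_sig cardsD (setIidPr (center_sub G)) oG -/z.
  by rewrite mulnBr muln1 mulnA.
have fiberE i : #|c @^-1: [set i]|
    = #|[set x in G :\: 'Z(G)%g | commuting_class G T x == i]|.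
  rewrite -(card_imset _ val_inj); apply: eq_card => x; rewrite !inE.
  apply/imsetP/andP => [[y] | [xGZ cxi]].
    by rewrite !inE => cyi ->; have := valP y; rewrite !inE.
  have xGZ' : x \in G :\: 'Z(G)%g by rewrite !inE.
  by exists (Sub x xGZ'); rewrite ?inE.
have fiber1 : #|c @^-1: [set 1%g]| = ((h - 1) * z)%N.
  rewrite fiberE commuting_class_fiber1 // cardsD (setIidPr sZT) oT -/z.
  by rewrite mulnBl mul1n mulnC.
have QP i : i \in Q -> exists2 x, x \in G :\: T & i = coset 'Z(G)%g x.
  by case/morphimP=> x _ xGT ->; exists x.
have fiberQ i : i \in Q -> #|c @^-1: [set i]| = z.
  by case/QP=> x xGT ->; rewrite fiberE commuting_class_fiber // card_rcoset.
have notQ1 : 1%g \notin Q.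
  apply/negP=> /QP[x /setDP[xG xT'] /esym cx1]; case/negP: xT'.
  apply: (subsetP sZT); exact: coset_idr (norm_center xG) cx1.
have imc : c @: setT = 1%g |: Q.
  apply/setP=> i; rewrite !inE; apply/imsetP/orP => [[x _ ->]|].
    have /setDP[xG _] := valP x; rewrite /c /commuting_class.
    have [xT | xT'] := boolP (val x \in T); first by left.
    by right; apply: mem_morphim; rewrite ?norm_center // inE xT'.
  have fiber_ne0 j : (0 < #|c @^-1: [set j]|)%N ->
      exists2 x, x \in setT & j = c x.
    by case/card_gt0P=> x; rewrite !inE => /eqP <-; exists x.
  case=> [/eqP->|iQ]; apply: fiber_ne0; last by rewrite fiberQ.
  by rewrite fiber1 muln_gt0 subn_gt0 h_gt1.
have /permPl-> := cluster_graph_spectrum C (c := c)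
  (fun x y => congr1 (andb (x != y))
    (commuting_classP sTG abT indT (valP x) (valP y))).
rewrite imc cardsU1 notQ1 oQ oV.
have -> : ((2 * h - 1) * z - h - 1 = z * (h * 2 - 1) - (true + h))%N.
  by rewrite -subnDA mulnC [(2 * h)%N]mulnC [(h + 1)%N]addnC.
rewrite perm_cat2l perm_sym perm_catC perm_sym /=.
have enumE : perm_eq (enum (1%g |: Q)) (1%g :: enum Q).
  apply: uniq_perm; rewrite ?enum_uniq //= ?mem_enum ?notQ1 ?enum_uniq //.
  by move=> i; rewrite inE !mem_enum in_setU1.
rewrite (permPl (perm_map _ enumE)) /= fiber1 natrM natrB ?(ltnW h_gt1) //.
rewrite perm_cons (_ : map _ _ = nseq h (z%:R - 1)) //.
have /eq_in_map-> : {in enum Q, (fun i => #|c @^-1: [set i]|%:R - 1)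
    =1 (fun=> z%:R - 1 : C)} by move=> i; rewrite mem_enum => /fiberQ->.
by rewrite -oQ cardE; elim: (enum Q) => //= _ s ->.
Qed.

(** * The dihedral quotient *)

(** With generators [a], [b] as in the presentation, the relations give
    [D = <a> <b>], [|<a>| <= m] and [|<b>| <= 2]; as [|D| = 2m], the first bound
    is attained. *)
Lemma dihedral_cyclic_index2 m (gT : finGroupType) (D : {group gT}) :
  (1 < m)%N -> (D \isog [set: 'D_(2 * m)])%g ->
  exists2 A : {group gT}, (A \subset D) && cyclic A
    & #|A| = m /\ #|D : A|%g = 2%N.
Proof.
move=> m_gt1 isoD.
have oD : #|D| = (m * 2)%N.
  by rewrite (card_isog isoD) mul2n card_dihedral // -muln2.
have := isoGrp_hom (isoGrp_trans isoD (Grp_dihedral_conj m_gt1)).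
case/existsP=> -[a b] /=; rewrite !xpair_eqE => /and4P[].
move=> /eqP defD /eqP am /eqP b2 /eqP ab.
have leA : (#|<[a]>%g| <= m)%N.
  by rewrite dvdn_leq ?(ltnW m_gt1) // order_dvdn am.
have leB : (#|<[b]>%g| <= 2)%N by rewrite dvdn_leq // order_dvdn b2.
have nAB : (<[b]> \subset 'N(<[a]>))%g.
  rewrite cycle_subG -groupV inE -cycleJ cycle_subG.
  by rewrite conjgE invgK mulgA ab groupV cycle_id.
have sAD : (<[a]> \subset D)%g by rewrite -defD joing_subl.
have leD : (m * 2 <= #|<[a]>%g| * #|<[b]>%g|)%N.
  by rewrite -oD -defD (norm_joinEr nAB) mul_cardG leq_pmulr.
have oA : #|<[a]>%g| = m.
  apply/eqP; rewrite eqn_leq leA -(leq_pmul2r (isT : 0 < 2)%N).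
  by rewrite (leq_trans leD) // leq_mul2l leB orbT.
exists <[a]>%G; first by rewrite sAD cycle_cyclic.
by rewrite -divgS // oD oA mulKn // ltnW.
Qed.

(** The index of [Z(G)] in the preimage of the cyclic subgroup of order [m] is
    [m]. *)
Theorem theorem2p5 (C : numClosedFieldType) (m : nat) (hm : (2 <= m)%N)
    (gT : finGroupType) (G : {group gT})
    (hG : (G / 'Z(G))%g \isog [set: 'D_(2 * m)]) :
  perm_eq (graph_spectrum C (commuting_graph (G := G)))
    (nseq ((2 * m - 1) * #|'Z(G)%g| - m - 1)%N (-1)
     ++ nseq m (#|'Z(G)%g|%:R - 1)
     ++ nseq 1 ((m%:R - 1) * #|'Z(G)%g|%:R - 1)).
Proof.
have [A /andP[sAG cycA] [oA indA]] := dihedral_cyclic_index2 hm hG.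
pose T := (coset 'Z(G) @*^-1 A)%G.
have GE : (coset 'Z(G) @*^-1 (G / 'Z(G)) = G)%g.
  exact: quotientGK (center_normal G).
have sTG : T \subset G by rewrite -GE morphpreS.
have indT : #|G : T|%g = 2%N by rewrite -indA -index_cosetpre /= GE.
have sZT : ('Z(G) \subset T)%g := sub_cosetpre _.
have abT : abelian T.
  apply: (@cyclic_factor_abelian _ 'Z(G)%G).
    by rewrite subsetI sZT centsC (subset_trans sTG) // centsC subsetIr.
  by rewrite cosetpreK.
have nabG : ~~ abelian G.
  apply/negP=> /center_idP ZG; have := Lagrange sAG.
  rewrite indA oA /= card_quotient ?normal_norm ?center_normal //= ZG indexgg.
  by move/eqP; rewrite muln_eq1 andbF.
have := spectrum_commuting_graph_abelian_index2 C sTG abT indT nabG.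
have -> : #|T : 'Z(G)|%g = m; last by [].
by rewrite -divgS // card_cosetpre oA mulKn ?cardG_gt0.
Qed.
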